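(* The following list of 25 types of tetrahedra is complete, i.e. every tetrahedron $V_1V_2V_3V_4$ in $\mathbb{R}^3$ is, up to permutation of its vertices, of one of the 25 types, where a type is given by the pattern of the edge-length sextuple $(d_{12},d_{13},d_{14},d_{23},d_{24},d_{34})$ and different letters stand for different lengths: (a) $(a,a,a,a,a,a)$; (b) $(a,b,a,a,b,a)$; (c) $(a,a,b,b,b,a)$; (d) $(a,a,a,a,a,b)$; (e) $(a,a,a,b,b,b)$; (f) $(b,a,b,a,a,a)$; (g) $(a,b,c,c,b,a)$; (h) $(a,b,c,c,b,b)$; (i) $(a,b,a,a,c,a)$; (j) $(a,a,a,b,c,b)$; (k) $(b,c,b,a,a,a)$; (l) $(a,b,b,c,c,a)$; (m) $(a,b,c,a,a,a)$; (n) $(a,b,a,a,c,b)$; (o) $(a,b,c,a,c,b)$; (p) $(a,c,b,b,d,a)$; (q) $(a,c,b,a,d,b)$; (r) $(a,a,a,b,c,d)$; (s) $(a,b,c,d,d,d)$; (t) $(a,b,a,a,c,d)$; (u) $(a,a,b,b,c,d)$; (v) $(a,b,c,a,c,d)$; (w) $(b,a,c,d,a,e)$; (x) $(a,b,c,a,d,e)$; (y) $(a,b,c,d,e,f)$.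
   Context: A tetrahedron means a nondegenerate tetrahedron in $\mathbb{R}^3$; $d_{ij}$ is the length of the edge joining $V_i$ and $V_j$. A tetrahedron is of a given type if, after some permutation of its vertices, its sextuple $(d_{12},d_{13},d_{14},d_{23},d_{24},d_{34})$ has the listed pattern for some pairwise distinct positive real values of the letters occurring in it. *)

(* Defs.v *)
From mathcomp Require Import all_boot all_order all_algebra all_fingroup.
From mathcomp Require Import reals.

Set Implicit Arguments.
Unset Strict Implicit.
Unset Printing Implicit Defensive.

Import Order.TTheory GRing.Theory Num.Theory.
Local Open Scope ring_scope.

(* The vertices V_1, V_2, V_3, V_4 are V 0, V 1, V 2, V 3.
   Nondegenerate: the edge vectors issued from V_1 are linearly independent. *)
Definition tetrahedron (R : realType) (V : 'I_4 -> 'rV[R]_3) : Prop :=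
  row_free (\matrix_(i < 3) (V (lift ord0 i) - V ord0)).

(* The norm `|x - y| is not used here: on matrices it is the sup norm. *)
Definition dist (R : realType) (x y : 'rV[R]_3) : R :=
  Num.sqrt (\sum_(k < 3) (x 0 k - y 0 k) ^+ 2).

Definition edge_lengths (R : realType) (V : 'I_4 -> 'rV[R]_3) : seq R :=
  [:: dist (V 0) (V 1); dist (V 0) (V 2); dist (V 0) (V 3);
      dist (V 1) (V 2); dist (V 1) (V 3); dist (V 2) (V 3)].

(* A letter is a natural number, and a pattern is a word of letters. *)
Definition has_pattern (R : realType) (p : seq nat) (d : seq R) : Prop :=
  exists v : nat -> R,
    [/\ {in p, forall x, 0 < v x}, {in p &, injective v} & d = map v p].

Definition of_type (R : realType) (p : seq nat) (V : 'I_4 -> 'rV[R]_3) : Prop :=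
  exists s : 'S_4, has_pattern p (edge_lengths (fun i => V (s i))).

Definition tetrahedron_types : seq (seq nat) :=
  let a := 0%N in let b := 1%N in let c := 2%N in
  let d := 3%N in let e := 4%N in let f := 5%N in
  [:: [:: a; a; a; a; a; a];
      [:: a; b; a; a; b; a];
      [:: a; a; b; b; b; a];
      [:: a; a; a; a; a; b];
      [:: a; a; a; b; b; b];
      [:: b; a; b; a; a; a];
      [:: a; b; c; c; b; a];
      [:: a; b; c; c; b; b];
      [:: a; b; a; a; c; a];
      [:: a; a; a; b; c; b];
      [:: b; c; b; a; a; a];
      [:: a; b; b; c; c; a];
      [:: a; b; c; a; a; a];
      [:: a; b; a; a; c; b];
      [:: a; b; c; a; c; b];
      [:: a; c; b; b; d; a];
      [:: a; c; b; a; d; b];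
      [:: a; a; a; b; c; d];
      [:: a; b; c; d; d; d];
      [:: a; b; a; a; c; d];
      [:: a; a; b; b; c; d];
      [:: a; b; c; a; c; d];
      [:: b; a; c; d; a; e];
      [:: a; b; c; a; d; e];
      [:: a; b; c; d; e; f]
  ].

(* Main.v *)
Require Import Defs.
From mathcomp Require Import all_boot all_order all_algebra all_fingroup.
From mathcomp Require Import reals.

(** Only which edges have equal lengths matters: every partition of the six
    edges becomes, under a suitable permutation of the vertices, the partition
    given by one of the 25 types.  A partition is encoded by the word sending
    each edge to the first edge of its class, so this is a finite check over
    words [w] with [w_i <= i].  Nondegeneracy only serves to make the lengths
    positive. *)

Set Implicit Arguments.
Unset Strict Implicit.
Unset Printing Implicit Defensive.

Import Order.TTheory GRing.Theory Num.Theory.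
Local Open Scope ring_scope.

Definition canon (T : eqType) (s : seq T) : seq nat :=
  [seq index x s | x <- s].

Lemma size_canon (T : eqType) (s : seq T) : size (canon s) = size s.
Proof. exact: size_map. Qed.

Lemma canonK (T : eqType) (x0 : T) (s : seq T) :
  [seq nth x0 s i | i <- canon s] = s.
Proof. by rewrite -map_comp map_id_in // => x xs /=; rewrite nth_index. Qed.

Lemma nth_canon_inj (T : eqType) (x0 : T) (s : seq T) :
  {in canon s &, injective (nth x0 s)}.
Proof.
by move=> _ _ /mapP[x xs ->] /mapP[y ys ->]; rewrite !nth_index // => ->.
Qed.

(** First occurrences depend only on which entries coincide, so [canon] is a normal form up to
    injective renaming of letters. *)
Lemma canon_map (T U : eqType) (f : T -> U) (s : seq T) :
  {in s &, injective f} -> canon (map f s) = canon s.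
Proof.
move=> f_inj; rewrite /canon -map_comp; apply/eq_in_map => x xs /=.
elim: s x xs f_inj => //= y s IHs x xys f_inj.
rewrite (inj_in_eq f_inj) ?mem_head //; case: eqVneq => // y'x.
have xs : x \in s by move: xys; rewrite inE eq_sym (negPf y'x).
by rewrite IHs // => u v us vs; apply: f_inj; rewrite inE ?us ?vs orbT.
Qed.

(** For [n = 6] these are 720 words. Some are not of the form [canon s], which is harmless: any word
    still describes a partition of the positions. *)
Fixpoint words (n : nat) : seq (seq nat) :=
  if n is m.+1 then [seq rcons w k | w <- words m, k <- iota 0 m.+1]
  else [:: [::]].

Lemma canon_words (T : eqType) (s : seq T) : canon s \in words (size s).
Proof.
elim/last_ind: s => [//|s x IHs]; rewrite size_rcons.
have -> : canon (rcons s x) = rcons (canon s) (index x (rcons s x)).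
  rewrite /canon map_rcons; congr rcons.
  by apply/eq_in_map => y ys; rewrite -cats1 index_cat ys.
apply: allpairs_f => //; rewrite mem_iota /= add0n.
by rewrite -(size_rcons s x) index_mem mem_rcons mem_head.
Qed.

Definition edges : seq (nat * nat) :=
  [:: (0, 1); (0, 2); (0, 3); (1, 2); (1, 3); (2, 3)]%N.

(** The endpoints are sorted because [edges] lists only increasing pairs. *)
Definition edge_index (i j : nat) : nat := index (minn i j, maxn i j) edges.

Definition relabel (l w : seq nat) : seq nat :=
  [seq nth 0%N w (edge_index (nth 0%N l e.1) (nth 0%N l e.2)) | e <- edges].

(** [canon] is applied on both sides because relabelling the vertices destroys canonicity and the
    letters of the types are not first positions. *)
Lemma words_relabel :
  all (fun w => has (fun l => has (fun t => canon (relabel l w) == canon t)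
    tetrahedron_types) (permutations (iota 0 4))) (words 6).
Proof. by vm_compute. Qed.

Lemma mem_edges (i j : nat) : ((i, j) \in edges) = (i < j < 4)%N.
Proof. by move: i j => [|[|[|[|i]]]] [|[|[|[|j]]]]; rewrite ?ltnS ?andbF. Qed.

Lemma minmax_edges (i j : nat) :
  (i < 4)%N -> (j < 4)%N -> i != j -> (minn i j, maxn i j) \in edges.
Proof.
move=> i4 j4; rewrite mem_edges neq_ltn => /orP[] ij.
  by rewrite (minn_idPl (ltnW ij)) (maxn_idPr (ltnW ij)) ij.
by rewrite (minn_idPr (ltnW ij)) (maxn_idPl (ltnW ij)) ij.
Qed.

Lemma perm_of_permutation n (l : seq nat) :
  l \in permutations (iota 0 n) ->
  exists s : 'S_n, forall i, s i = nth 0%N l i :> nat.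
Proof.
rewrite mem_permutations => l_perm.
have sz : size l = n by rewrite (perm_size l_perm) size_iota.
have l_uniq : uniq l by rewrite (perm_uniq l_perm) iota_uniq.
have lt_n (i : 'I_n) : (nth 0%N l i < n)%N.
  have : nth 0%N l i \in l by rewrite mem_nth // sz.
  by rewrite (perm_mem l_perm) mem_iota.
have f_inj : injective (fun i => Ordinal (lt_n i)).
  by move=> i j [] /eqP; rewrite nth_uniq ?sz // => /eqP/val_inj.
by exists (perm f_inj) => i; rewrite permE.
Qed.

Section Lengths.
Variable R : realType.
Implicit Types (p : seq nat) (d : seq R) (V : 'I_4 -> 'rV[R]_3).

Lemma canon_has_pattern p d :
  {in d, forall x, 0 < x} -> canon p = canon d -> has_pattern p d.
Proof.
(* A letter takes the length found at its first position in [p]; by [pd] this is also the first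
   position of its class in [d]. *)
move=> d_gt0 pd; exists (fun x => nth 0 d (index x p)).
have pcd x : x \in p -> index x p \in canon d.
  by rewrite -pd => xp; apply: map_f.
split=> [x /pcd xd|x y xp yp xy|].
- by apply: d_gt0; case/mapP: xd => y yd ->; rewrite nth_index.
- rewrite -(nth_index 0%N xp) (nth_canon_inj (pcd _ xp) (pcd _ yp) xy).
  by rewrite nth_index.
- by rewrite -[LHS](canonK 0) -pd -map_comp.
Qed.

Lemma distC (x y : 'rV[R]_3) : dist x y = dist y x.
Proof. by congr Num.sqrt; apply: eq_bigr => k _; rewrite -sqrrN opprB. Qed.

Lemma dist_gt0 (x y : 'rV[R]_3) : x != y -> 0 < dist x y.
Proof.
move=> xy; have sq_ge0 (k : 'I_3) : true -> 0 <= (x 0 k - y 0 k) ^+ 2.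
  by rewrite sqr_ge0.
rewrite sqrtr_gt0 lt0r sumr_ge0 // andbT.
apply: contra xy; rewrite psumr_eq0 // => /allP xy0.
apply/eqP/rowP => k; apply/eqP; rewrite -subr_eq0 -sqrf_eq0.
by apply: xy0; rewrite mem_index_enum.
Qed.

(** Right multiplication by the matrix [A] of edge vectors is injective, so two coinciding vertices
    would make a unit row vector zero or equal to another one. *)
Lemma tetrahedron_inj V : tetrahedron V -> injective V.
Proof.
rewrite /tetrahedron; set A := (X in row_free X) => /row_free_inj A_inj.
have VA (i : 'I_3) : V (lift ord0 i) - V ord0 = delta_mx 0 i *m A.
  by rewrite -rowE rowK.
have neq0 (i : 'I_3) : V (lift ord0 i) <> V ord0.
  move=> /eqP; rewrite -subr_eq0 VA => /eqP.
  rewrite -(mul0mx _ A) => /A_inj /matrixP/(_ 0 i)/eqP.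
  by rewrite !mxE !eqxx oner_eq0.
have lift_inj (i j : 'I_3) : V (lift ord0 i) = V (lift ord0 j) -> i = j.
  move=> /(congr1 (fun x => x - V ord0)); rewrite !VA => /A_inj.
  move=> /matrixP/(_ 0 i)/eqP; rewrite !mxE !eqxx /=.
  by case: (eqVneq i j) => [-> //|_]; rewrite oner_eq0.
move=> i j; case: (unliftP ord0 i) (unliftP ord0 j) => [i'|] -> [j'|] ->.
- by move=> /lift_inj ->.
- by move=> /neq0.
- by move=> /esym/neq0.
- by [].
Qed.

Lemma edge_lengthsE V :
  edge_lengths V = [seq dist (V (inord e.1)) (V (inord e.2)) | e <- edges].
Proof.
have o0 : inord 0 = 0 :> 'I_4 by apply: val_inj; rewrite /= inordK.
have o1 : inord 1 = 1 :> 'I_4 by apply: val_inj; rewrite /= inordK.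
have o2 : inord 2 = 2 :> 'I_4 by apply: val_inj; rewrite /= inordK.
have o3 : inord 3 = 3 :> 'I_4 by apply: val_inj; rewrite /= inordK.
by rewrite /= o0 o1 o2 o3.
Qed.

Lemma edge_lengths_gt0 V :
  injective V -> {in edge_lengths V, forall x, 0 < x}.
Proof.
move=> V_inj x; rewrite edge_lengthsE => /mapP[[i j]].
rewrite mem_edges => /andP[ij j4] -> /=; apply: dist_gt0.
rewrite (inj_eq V_inj) -val_eqE /= !inordK //; last exact: ltn_trans j4.
by rewrite neq_ltn ij.
Qed.

Lemma dist_edge_index V (i j : 'I_4) : i != j ->
  dist (V i) (V j) = nth 0 (edge_lengths V) (edge_index i j).
Proof.
move=> ij; have ijE := minmax_edges (ltn_ord i) (ltn_ord j) ij.
rewrite edge_lengthsE (nth_map (0, 0)%N) ?index_mem // nth_index //=.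
(* When sorting has swapped the endpoints, symmetry of the distance is used. *)
case: (leqP i j) => _; rewrite !inord_val //; exact: distC.
Qed.

(** The inclusion is recorded because [nth 0 d] is only known to be injective on [canon d]: distinct
    positions of [d] may carry equal lengths. *)
Lemma edge_lengths_relabel V (s : 'S_4) (l : seq nat) (d := edge_lengths V) :
  (forall i, s i = nth 0%N l i :> nat) ->
  edge_lengths (fun i => V (s i)) = [seq nth 0 d k | k <- relabel l (canon d)]
  /\ {subset relabel l (canon d) <= canon d}.
Proof.
move=> sl.
have sE e : e \in edges -> s (inord e.1) != s (inord e.2)
    /\ edge_index (s (inord e.1)) (s (inord e.2))
       = edge_index (nth 0%N l e.1) (nth 0%N l e.2).
  case: e => i j; rewrite mem_edges => /andP[ij j4] /=.
  have i4 := ltn_trans ij j4.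
  rewrite !sl !inordK // (inj_eq perm_inj) -val_eqE /= !inordK //.
  by rewrite neq_ltn ij.
have lt_d e : e \in edges ->
    (edge_index (nth 0%N l e.1) (nth 0%N l e.2) < size (canon d))%N.
  move=> /sE[sij <-]; rewrite size_canon -[size d]/(size edges) index_mem.
  exact: minmax_edges.
split=> [|_ /mapP[e /lt_d le ->]]; last exact: mem_nth.
rewrite edge_lengthsE -map_comp; apply/eq_in_map => e eE /=.
have [sij idx] := sE _ eE; rewrite dist_edge_index // idx.
(* The length of an edge is read at the first edge of its class, whose position is the letter in
   [canon d]. *)
by rewrite -[in LHS](canonK 0 (edge_lengths V)) (nth_map 0%N) ?lt_d.
Qed.

End Lengths.

Theorem proposition6p2 (R : realType) (V : 'I_4 -> 'rV[R]_3)
    (hV : tetrahedron V) :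
  exists2 p : seq nat, p \in tetrahedron_types & of_type p V.
Proof.
have V_inj := tetrahedron_inj hV.
set d := edge_lengths V.
have /hasP[l l_perm /hasP[p pT /eqP lp]] :=
  allP words_relabel _ (canon_words d).
have [s sl] := perm_of_permutation l_perm.
have [dE sub] := edge_lengths_relabel V sl.
exists p => //; exists s; apply: canon_has_pattern.
  by apply: edge_lengths_gt0 => i j /V_inj/perm_inj.
(* The new lengths are an injective renaming of the relabelled word, so both have the same normal
   form, which is that of [p] by [lp]. *)
rewrite dE canon_map // => i j /sub ic /sub jc; exact: nth_canon_inj.
Qed.
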